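(* The asymptotics of the sequences $\alpha_n(\mathbf{a},\mathbf{a})$, $\alpha_n(\mathbf{a},\mathbf{b})$, $\alpha_n(\mathbf{b},\mathbf{b})$ and $\alpha_n$ are given by $$\begin{aligned}\alpha_n(\mathbf{a},\mathbf{a})/n!&=e-4+4/e+O(r^n),\\ \alpha_n(\mathbf{a},\mathbf{b})/n!&=1-2/e+O(r^n),\\ \alpha_n(\mathbf{b},\mathbf{b})/n!&=1/e+O(r^n),\\ \alpha_n/n!&=e-2+1/e+O(r^n),\end{aligned}$$ where $r$ is an arbitrary small positive real number.
   Context: The descent word of a permutation $\pi=\pi_1\cdots\pi_n\in\mathfrak{S}_n$ is $u(\pi)=u_1\cdots u_{n-1}$, with $u_i=\mathbf{a}$ if $\pi_i<\pi_{i+1}$ and $u_i=\mathbf{b}$ if $\pi_i>\pi_{i+1}$. Set $\mathrm{wt}(\mathbf{aa})=0$, $\mathrm{wt}(\mathbf{bb})=2$, $\mathrm{wt}(\mathbf{ab})=\mathrm{wt}(\mathbf{ba})=1$, and $\mathrm{Wt}(\pi)=\prod_{i=1}^{n-2}\mathrm{wt}(u_iu_{i+1})$ (an empty product is $1$). For $n\ge2$, $\alpha_n=\sum_{\pi\in\mathfrak{S}_n}\mathrm{Wt}(\pi)$, and for $x,y\in\{\mathbf{a},\mathbf{b}\}$, $\alpha_n(x,y)=\sum\mathrm{Wt}(\pi)$ over all $\pi\in\mathfrak{S}_n$ whose descent word begins with the letter $x$ and ends with the letter $y$. Equivalently, the sums are over permutations with no double ascent, weighted by $2$ to the number of double descents.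 The $O(r^n)$ statements are as $n\to\infty$. *)

(* Defs.v *)
From mathcomp Require Import all_boot all_order all_fingroup all_algebra.
From mathcomp Require Import all_classical all_reals all_analysis.

Set Implicit Arguments.
Unset Strict Implicit.
Unset Printing Implicit Defensive.

(* Descent words are words over booleans: [true] means "descent". *)
Definition letter := bool.
Definition a : letter := false.
Definition b : letter := true.

(* [one_line pi] is pi_1 ... pi_n; since 'I_n is {0, ..., n-1}, positions and
   values are shifted down by one, which does not affect descents. *)
Definition one_line n (pi : 'S_n) : seq nat := [seq val (pi i) | i <- enum 'I_n].

Definition descent_word n (pi : 'S_n) : seq letter :=
  mkseq (fun i => if (nth 0 (one_line pi) i < nth 0 (one_line pi) i.+1)%N
                  then a else b) n.-1.

Definition wt (x y : letter) : nat :=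
  match x, y with
  | false, false => 0
  | true, true => 2
  | _, _ => 1
  end.

Definition Wt n (pi : 'S_n) : nat :=
  (\prod_(0 <= i < n - 2)
    wt (nth a (descent_word pi) i) (nth a (descent_word pi) i.+1))%N.

Definition alpha (n : nat) : nat := (\sum_(pi : 'S_n) Wt pi)%N.

Definition alpha_ends (x y : letter) (n : nat) : nat :=
  (\sum_(pi : 'S_n | prefix [:: x] (descent_word pi)
                     && suffix [:: y] (descent_word pi)) Wt pi)%N.

(* Main.v *)
(** Deleting the last entry of a permutation of [N + 1] letters gives a linear
recursion for [H N k] and [G N k], the weighted numbers of those permutations
with last value [k] whose descent word ends in [b], resp. is arbitrary (a
first letter [x] carrying the weight [f x]):
[H (N+1) j = \sum_(k >= j) (H + G) N k] and
[(G - H) (N+1) j = \sum_(k < j) H N k].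
It is solved by the difference table of the sequence [q 0 = f b - f a],
[q (n+1) = (n+1) q n + f a]: [G N k] is the [k]-th difference of [q] at [N - k]
and [H N k] is [N - k] times the one at [N - k - 1], up to a boundary term at
[k = 0].  Summing over [k] and dividing by [n!], the totals become partial sums
of the exponential series at [1] and [-1], whose tails are [O(r^n)] because
[1 / k! <= r^n (1/r)^k / k!] for [k >= n] and [r <= 1]. *)

Require Import Defs.
From mathcomp Require Import all_boot all_order all_fingroup all_algebra.
From mathcomp Require Import all_classical all_reals all_analysis.
From mathcomp Require Import ring zify.
Import Order.TTheory GRing.Theory Num.Theory numFieldNormedType.Exports.
Local Open Scope classical_set_scope.
Local Open Scope ring_scope.

Set Implicit Arguments.
Unset Strict Implicit.
Unset Printing Implicit Defensive.

(** * Appending a last entry to a permutation *)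

Lemma nth_one_line n (s : 'S_n) (i : 'I_n) : nth 0%N (one_line s) i = s i.
Proof. by rewrite (nth_map i) ?size_enum_ord // nth_ord_enum. Qed.

Lemma ltn_lift n (h : 'I_n.+1) (i j : 'I_n) :
  (lift h i < lift h j)%N = (i < j)%N.
Proof. by rewrite !ltnNge /= leq_bump2. Qed.

(** [lift_perm ord_max j s] appends the value [j] to [s], after raising the values at least [j] by
    one; so the old order is kept, and the old last value ends above [j] exactly when it was at
    least [j]. *)
Lemma descent_word_lift n (s : 'S_n.+1) (j : 'I_n.+2) :
  descent_word (lift_perm ord_max j s) =
  rcons (descent_word s) (j <= s ord_max)%N.
Proof.
have ol (i : 'I_n.+1) :
    nth 0%N (one_line (lift_perm ord_max j s)) i = lift j (s i).
  have -> : i = lift ord_max i :> nat by rewrite lift_max.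
  by rewrite nth_one_line lift_perm_lift.
rewrite /descent_word mkseqS; congr rcons.
  apply/eq_in_map => i; rewrite mem_iota add0n => /andP[_ lt_in].
  have lt_in1 : (i < n.+1)%N by exact: ltnW.
  rewrite (ol (Ordinal lt_in1)) (ol (Ordinal (lt_in : i.+1 < n.+1)%N)) ltn_lift.
  rewrite (nth_one_line s (Ordinal lt_in1)).
  by rewrite (nth_one_line s (Ordinal (lt_in : i.+1 < n.+1)%N)).
rewrite -[X in nth _ _ X]/(nat_of_ord (@ord_max n)) ol.
rewrite -[n.+1]/(nat_of_ord (@ord_max n.+1)) nth_one_line lift_perm_id /=.
rewrite /bump; case: (leqP j (s ord_max)) => /= [le_j|lt_j]; last first.
  by rewrite add0n lt_j.
by rewrite ltnNge leqW.
Qed.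

Lemma size_descent_word n (s : 'S_n.+1) : size (descent_word s) = n.
Proof. exact: size_mkseq. Qed.

Lemma Wt_lift n (s : 'S_n.+2) (j : 'I_n.+3) :
  Wt (lift_perm ord_max j s) =
  (Wt s * wt (last a (descent_word s)) (j <= s ord_max))%N.
Proof.
rewrite /Wt !subSS !subn0 big_nat_recr // descent_word_lift; congr (_ * _)%N.
  apply: eq_big_nat => i /andP[_ lt_in].
  have lt_in1 : (i.+1 < n.+1)%N by [].
  by rewrite !nth_rcons size_descent_word lt_in1 (ltnW lt_in1).
rewrite !nth_rcons size_descent_word ltnn eqxx ltnSn.
by rewrite -nth_last size_descent_word.
Qed.

Lemma sum_lift_perm (V : nmodType) n (F : 'S_n.+1 -> V) :
  \sum_s F s = \sum_(s : 'S_n) \sum_(j < n.+1) F (lift_perm ord_max j s).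
Proof.
pose h (p : 'S_n * 'I_n.+1) := lift_perm ord_max p.2 p.1.
have h_inj : injective h.
  move=> [s j] [s' j'] /permP eq_h; congr (_, _).
    apply/permP => k; have := eq_h (lift ord_max k).
    have := eq_h ord_max; rewrite /h !lift_perm_id /= => ->.
    by rewrite !lift_perm_lift => /lift_inj.
  by have := eq_h ord_max; rewrite /h !lift_perm_id.
have h_bij : bijective h.
  apply: (inj_card_bij h_inj).
  by rewrite card_prod card_ord !card_Sn factS mulnC.
by rewrite (reindex h) /=; [rewrite pair_big | exact: onW_bij].
Qed.

(** * The difference table of [qseq] *)

Section DifferenceTable.
Variables (R : comNzRingType) (q0 t : R).

Fixpoint qseq n : R := if n is m.+1 then n%:R * qseq m + t else q0.

Fixpoint qdiff m j : R :=
  if j is i.+1 then qdiff m.+1 i - qdiff m i else qseq m.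

Lemma qdiffn0 m : qdiff m 0 = qseq m.
Proof. by []. Qed.

(** This is the Leibniz rule for the [j.+1]-st difference of [m.+1%:R * qseq m + t]: the first
    factor is linear in [m] and the constant disappears. *)
Lemma qdiff_rec m j :
  qdiff m.+1 j.+1 = m.+1%:R * qdiff m j.+1 + j.+1%:R * qdiff m.+1 j.
Proof.
elim: j m => [|j IHj] m; first by rewrite /= -!natr1; ring.
have E k : qdiff k j.+2 = qdiff k.+1 j.+1 - qdiff k j.+1 by [].
have E' k : qdiff k.+1 j = qdiff k j.+1 + qdiff k j by rewrite /= subrK.
rewrite !E (IHj m.+1) (E' m.+1) (IHj m).
by rewrite -!natr1; ring.
Qed.

(** For [q0 = 1] and [t = 0] this is the recurrence of the derangement numbers, the source of
    [1 / e]. *)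
Lemma qdiff0S j :
  qdiff 0 j.+1 = j.+1%:R * qdiff 0 j + (-1) ^+ j.+1 * (q0 - t).
Proof.
elim: j => [|j IHj]; first by rewrite /=; ring.
have -> : qdiff 0 j.+2 = qdiff 1 j.+1 - qdiff 0 j.+1 by [].
rewrite qdiff_rec.
have -> : qdiff 1 j = qdiff 0 j.+1 + qdiff 0 j by rewrite /= subrK.
have H : j.+1%:R * qdiff 0 j = qdiff 0 j.+1 - (-1) ^+ j.+1 * (q0 - t).
  by rewrite IHj addrK.
by rewrite [_ * (_ + qdiff 0 j)]mulrDr H [(-1) ^+ j.+2]exprS -!natr1; ring.
Qed.

(* At [k = N] the truncated [(N - k).-1] is harmless: its factor is [0]. *)
Definition hcoef N k : R := (N - k)%:R * qdiff (N - k).-1 k + t *+ (k == 0%N).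

Definition gcoef N k : R := qdiff (N - k) k.

(** Differenced form of the recursion for a final [b], so that its sum telescopes; [gcoef_diff] does
    the same for a final [a]. *)
Lemma hcoef_diff N k : (k <= N)%N ->
  hcoef N k + gcoef N k = hcoef N.+1 k - hcoef N.+1 k.+1.
Proof.
move=> le_kN; rewrite /hcoef /gcoef subSS subSn //=.
case: (N - k)%N => [|m] /=; first by ring.
by rewrite -!natr1; ring.
Qed.

Lemma gcoef_diff N k : (k <= N)%N ->
  hcoef N k =
  (gcoef N.+1 k.+1 - hcoef N.+1 k.+1) - (gcoef N.+1 k - hcoef N.+1 k).
Proof.
move=> le_kN; rewrite -[LHS](addrK (gcoef N k)) hcoef_diff //.
by rewrite /gcoef subSS subSn //=; ring.
Qed.

Lemma sum_hgcoef N j : (j <= N.+1)%N ->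
  \sum_(j <= k < N.+1) (hcoef N k + gcoef N k) = hcoef N.+1 j.
Proof.
move=> le_jN; rewrite (@eq_big_nat _ _ _ _ _ _
  (fun k => - hcoef N.+1 k.+1 - - hcoef N.+1 k)); last first.
  by move=> k /andP[_ le_kN]; rewrite hcoef_diff // opprK addrC.
(* The upper end [hcoef N.+1 N.+1] vanishes. *)
by rewrite telescope_sumr // opprK /hcoef subnn mul0r !add0r oppr0 add0r.
Qed.

Lemma sum_hcoef N j : (j <= N.+1)%N ->
  \sum_(0 <= k < j) hcoef N k = gcoef N.+1 j - hcoef N.+1 j.
Proof.
move=> le_jN; rewrite (@eq_big_nat _ _ _ _ _ _ (fun k =>
  (gcoef N.+1 k.+1 - hcoef N.+1 k.+1) - (gcoef N.+1 k - hcoef N.+1 k))).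
  (* At [k = 0] the two coefficients agree by the recurrence of [qseq]; the boundary term [t] in
     [hcoef] serves this. No ascent ends at the least value. *)
  rewrite telescope_sumr // [X in _ - X](_ : _ = 0) ?subr0 //.
  by rewrite /gcoef /hcoef subn0 /= subrr.
by move=> k /andP[_ lt_kj]; apply: gcoef_diff; rewrite -ltnS (leq_trans lt_kj).
Qed.

End DifferenceTable.

(** * Weighted sums over permutations *)

Section WeightedSums.
Variables (R : comNzRingType) (f : letter -> R).

(** [g] tests the last letter and the last value. With [n.+2] entries the descent word is nonempty,
    so the default [a] is never read. *)
Definition wsum n (g : letter -> nat -> R) : R :=
  \sum_(s : 'S_n.+2) f (head a (descent_word s)) * (Wt s)%:R *
    g (last a (descent_word s)) (s ord_max).

Lemma wsumS n g :
  wsum n.+1 g =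
  wsum n (fun y k => \sum_(j < n.+3) (wt y (j <= k)%N)%:R * g (j <= k)%N j).
Proof.
rewrite /wsum sum_lift_perm; apply: eq_bigr => s _.
rewrite mulr_sumr; apply: eq_bigr => j _.
rewrite Wt_lift descent_word_lift lift_perm_id last_rcons natrM.
have -> : head a (rcons (descent_word s) (j <= s ord_max)%N) =
          head a (descent_word s).
  by have := size_descent_word s; case: (descent_word s).
by rewrite !mulrA.
Qed.

Lemma wsum0 g : wsum 0 g = f b * g b 0%N + f a * g a 1%N.
Proof.
rewrite /wsum sum_lift_perm (eq_bigr (fun=> f b * g b 0%N + f a * g a 1%N)).
  by rewrite sumr_const card_Sn.
move=> s _; rewrite big_ord_recl big_ord1 /Wt !big_geq // !mulr1.
rewrite !descent_word_lift !lift_perm_id !last_rcons.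
have -> : descent_word s = [::] by apply: size0nil; rewrite size_descent_word.
by rewrite (ord1 (s ord_max)).
Qed.

Let h := hcoef (f b - f a) (f a).
Let e := qdiff (f b - f a) (f a).

(* Induction over all test functions [g] at once: the recursion of [wsumS] acts
   on [g], and its transpose is the recursion solved by [hcoef] and [gcoef]. *)
Lemma wsumE n g :
  wsum n g = \sum_(k < n.+2) (h n.+1 k * g b k +
    (gcoef (f b - f a) (f a) n.+1 k - h n.+1 k) * g a k).
Proof.
elim: n g => [|n IHn] g.
  rewrite wsum0 big_ord_recl big_ord1 /h /hcoef /gcoef /=.
  by rewrite -[bump 0 0]/1%N subn0 subnn; ring.
rewrite wsumS IHn.
under eq_bigr do rewrite !mulr_sumr -big_split /=.
rewrite exchange_big; apply: eq_bigr => j _ /=.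
have le_j : (j <= n.+2)%N by rewrite -ltnS.
(* For [j <= k] the new letter is [b], with weight 2 after [b] and 1 after [a]:
   [2 H + (G - H) = H + G]. For [k < j] it is [a], and only [H] survives. *)
rewrite -(sum_hcoef _ _ le_j) big_mkord (big_ord_widen n.+2 _ le_j).
rewrite -[X in X * g b j](sum_hgcoef _ _ le_j) big_geq_mkord /= !mulr_suml.
rewrite [X in _ = X + _]big_mkcond [X in _ = _ + X]big_mkcond -big_split /=.
by apply: eq_bigr => k _; rewrite /h /b /a; case: leqP => _ /=; ring.
Qed.

Lemma wsum_last_b n : wsum n (fun y _ => (y == b)%:R) = e 0 n.+2.
Proof.
rewrite wsumE; under eq_bigr do rewrite mulr1 mulr0 addr0.
rewrite -(big_mkord predT (h n.+1)) sum_hcoef // /gcoef /hcoef subnn.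
by rewrite mul0r add0r subr0.
Qed.

(** The sum of [H + G] is [hcoef] at [k = 0] one level up, and [wsum_last_b] gives the sum of [H] to
    subtract. *)
Lemma wsum_all n : wsum n (fun _ _ => 1) = e n.+2 0 - e 0 n.+2.
Proof.
rewrite -wsum_last_b (_ : e n.+2 0 = h n.+2 0); last first.
  by rewrite /h /hcoef subn0.
rewrite /h -sum_hgcoef // wsumE.
rewrite wsumE big_mkord -sumrB; apply: eq_bigr => k _.
by rewrite /h /=; ring.
Qed.

End WeightedSums.

(** * The sequences of the theorem as weighted sums *)

Section AlphaEnds.
Variable R : comNzRingType.

Lemma alphaE n :
  (alpha n.+2)%:R = wsum (fun=> 1 : R) n (fun _ _ => 1).
Proof.
by rewrite /alpha natr_sum; apply: eq_bigr => s _; rewrite mul1r mulr1.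
Qed.

Lemma alpha_endsE x y n :
  (alpha_ends x y n.+2)%:R =
  wsum (fun z => (z == x)%:R : R) n (fun z _ => (z == y)%:R).
Proof.
rewrite /alpha_ends natr_sum big_mkcond; apply: eq_bigr => s _.
have -> : prefix [:: x] (descent_word s) = (head a (descent_word s) == x).
  have := size_descent_word s; case: (descent_word s) => // z w _.
  by rewrite /= prefix0s andbT eq_sym.
have -> : suffix [:: y] (descent_word s) = (last a (descent_word s) == y).
  have := size_descent_word s; case/lastP: (descent_word s) => [//|w z _].
  rewrite -[[:: y]]/(rcons [::] y) suffix_rcons suffix0s andbT.
  by rewrite last_rcons eq_sym.
by case: eqP; case: eqP => _ _ /=; rewrite ?(mul1r, mulr1, mulr0, mul0r).
Qed.

End AlphaEnds.

(** * Exponential tails and asymptotics *)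

Section Asymptotics.
Variable R : realType.
Implicit Types r x L : R.

Lemma series_exp_coeff_dist r x m n : 0 < r <= 1 -> `|x| <= 1 -> (m <= n)%N ->
  `|series (exp_coeff x) n - series (exp_coeff x) m| <= r ^+ m * expR r^-1.
Proof.
move=> /andP[r_gt0 r_le1] x_le1 le_mn.
have rV_ge0 : 0 <= r^-1 by rewrite invr_ge0 ltW.
rewrite sub_series_geq // (le_trans (ler_norm_sum _ _ _)) //.
have incr : nondecreasing_seq (series (exp_coeff r^-1)).
  by apply: nondecreasing_series => k _ _; exact: exp_coeff_ge0.
have /= := nondecreasing_cvgn_le incr (is_cvg_series_exp_coeff _) n.
rewrite -/(expR _) => le_expR.
apply: (@le_trans _ _ (r ^+ m * \sum_(m <= k < n) exp_coeff r^-1 k)).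
  rewrite mulr_sumr; apply: ler_sum_nat => k /andP[le_mk _].
  rewrite /exp_coeff /= normrM normrX mulrA normfV normr_nat.
  apply: ler_pM; rewrite ?exprn_ge0 ?invr_ge0 //.
  apply: (@le_trans _ _ 1); first exact: exprn_ile1.
  by rewrite exprVn ler_pdivlMr ?exprn_gt0 // mul1r ler_wiXn2l // ltW.
rewrite ler_pM2l ?exprn_gt0 // (le_trans _ le_expR) //.
rewrite /series /= (big_cat_nat (leq0n m) le_mn) /= lerDr sumr_ge0 // => k _.
exact: exp_coeff_ge0.
Qed.

Lemma expR_series_dist r x n : 0 < r <= 1 -> `|x| <= 1 ->
  `|series (exp_coeff x) n - expR x| <= r ^+ n * expR r^-1.
Proof.
move=> r01 x_le1; rewrite distrC.
have cv : `|series (exp_coeff x) m - series (exp_coeff x) n| @[m --> \oo] -->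
    `|expR x - series (exp_coeff x) n|.
  apply: cvg_norm; apply: cvgB; last exact: cvg_cst.
  exact: is_cvg_series_exp_coeff.
rewrite -(cvg_lim _ cv) //; apply: limr_le.
  by apply/cvg_ex; eexists; exact: cv.
near=> m; apply: series_exp_coeff_dist => //.
by near: m; exact: nbhs_infty_ge.
Unshelve. all: by end_near. Qed.

Lemma bigO_exp_series r (u : nat -> R) L c d : 0 < r ->
  (forall n, u n.+2 = L + c * (series (exp_coeff (-1)) n.+3 - expR (-1)) +
                          d * (series (exp_coeff 1) n.+3 - expR 1)) ->
  (u : nat -> R^o) = cst L +O_\oo (fun n => r ^+ n : R^o).
Proof.
move=> r_gt0 uE; apply/eqaddOP.
(* The tail bound needs a ratio at most 1, while [r] may be larger. *)
pose s := Num.min r 1; pose K := (`|c| + `|d|) * expR s^-1.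
have s01 : 0 < s <= 1 by rewrite lt_min r_gt0 ltr01 ge_min lexx orbT.
exists K; split; first exact: num_real.
move=> k /ltW le_Kk; near=> n.
have [m ->] : exists m, n = m.+2.
  by exists n.-2; have : (2 <= n)%N; [near: n; exact: nbhs_infty_ge|lia].
set A := series (exp_coeff (-1 : R)) m.+3 - expR (-1).
set B := series (exp_coeff (1 : R)) m.+3 - expR 1.
have -> : ((u : nat -> R^o) - cst L) m.+2 = c * A + d * B.
  by rewrite !fctE uE -[L + _ + _]addrA [L + _]addrC addrK.
have s_gt0 : 0 < s by case/andP: s01.
have le_sr : s ^+ m.+3 <= r ^+ m.+2.
  rewrite exprSr -[leRHS]mulr1 ler_pM ?exprn_ge0 ?(ltW s_gt0) //.
    by rewrite ler_pXn2r ?nnegrE ?(ltW s_gt0) ?(ltW r_gt0) // ge_min lexx.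
  by case/andP: s01.
have bound x : `|x| <= 1 ->
    `|series (exp_coeff x) m.+3 - expR x| <= r ^+ m.+2 * expR s^-1.
  move=> x_le1; apply: (le_trans (expR_series_dist _ s01 x_le1)).
  by rewrite ler_wpM2r // expR_ge0.
apply: (@le_trans _ _ (K * r ^+ m.+2)); last first.
  by rewrite ger0_norm ?ler_wpM2r ?exprn_ge0 // ltW.
rewrite (le_trans (ler_normD _ _)) // !normrM /K.
rewrite -mulrA [expR _ * _]mulrC mulrDl.
by rewrite lerD // ler_wpM2l // bound // ?normrN ?normr1.
Unshelve. all: by end_near. Qed.

(** Division by the factorial turns the recurrence of [qseq] into adding [t / n.+1!]; likewise
    [qdiff0S] yields the alternating series below. *)
Lemma qseq_fact (q0 t : R) n :
  qseq q0 t n / n`!%:R = q0 - t + t * series (exp_coeff 1) n.+1.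
Proof.
elim: n => [|n IHn].
  by rewrite /series /= big_nat1 /exp_coeff /= expr0 fact0 !divr1 mulr1
             subrK.
rewrite seriesSr mulrDr addrA -IHn /exp_coeff /= expr1n factS natrM.
have : n`!%:R != 0 :> R by rewrite pnatr_eq0 -lt0n fact_gt0.
have : n.+1%:R != 0 :> R by rewrite pnatr_eq0.
by move=> ? ?; field; apply/andP.
Qed.

Lemma qdiff0_fact (q0 t : R) n :
  qdiff q0 t 0 n / n`!%:R = t + (q0 - t) * series (exp_coeff (-1)) n.+1.
Proof.
elim: n => [|n IHn].
  by rewrite /series /= big_nat1 /exp_coeff /= expr0 fact0 !divr1 mulr1
             addrC subrK.
rewrite seriesSr mulrDr addrA -IHn qdiff0S /exp_coeff /= factS natrM.
have : n`!%:R != 0 :> R by rewrite pnatr_eq0 -lt0n fact_gt0.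
have : n.+1%:R != 0 :> R by rewrite pnatr_eq0.
by move=> ? ?; field; apply/andP.
Qed.

End Asymptotics.

Theorem theorem6p2 (R : realType) (r : R) (hr : 0 < r) :
  let e : R := expR 1 in
  [/\ (fun n : nat => (alpha_ends a a n)%:R / n`!%:R : R^o)
        = cst (e - 4 + 4 / e) +O_\oo (fun n : nat => r ^+ n : R^o),
      (fun n : nat => (alpha_ends a b n)%:R / n`!%:R : R^o)
        = cst (1 - 2 / e) +O_\oo (fun n : nat => r ^+ n : R^o),
      (fun n : nat => (alpha_ends b b n)%:R / n`!%:R : R^o)
        = cst (1 / e) +O_\oo (fun n : nat => r ^+ n : R^o) &
      (fun n : nat => (alpha n)%:R / n`!%:R : R^o)
        = cst (e - 2 + 1 / e) +O_\oo (fun n : nat => r ^+ n : R^o)].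
Proof.
move=> e.
have eV : e^-1 = expR (-1) by rewrite expRN.
have endsb x n : (alpha_ends x b n.+2)%:R =
    qdiff ((b == x)%:R - (a == x)%:R) (a == x)%:R 0 n.+2 :> R.
  by rewrite alpha_endsE wsum_last_b.
(* A first letter [a] means [q0 = -1], [t = 1]. The factor 2 arises because the total already
   contains one [- qdiff], and removing the words ending in [b] subtracts another. *)
have endsaa n : (alpha_ends a a n.+2)%:R =
    qseq (-1) 1 n.+2 - 2 * qdiff (-1) 1 0 n.+2 :> R.
  have aaE : (alpha_ends a a n.+2)%:R + (alpha_ends a b n.+2)%:R =
      wsum (fun z => (z == a)%:R : R) n (fun _ _ => 1).
    rewrite !alpha_endsE -big_split; apply: eq_bigr => s _ /=.
    by rewrite -mulrDr; case: (last _ _); rewrite /= ?addr0 ?add0r.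
  move/eqP: aaE; rewrite eq_sym -subr_eq => /eqP.
  by rewrite endsb wsum_all /= => <-; rewrite !sub0r; ring.
split.
(* In each case the two constants are the coefficients of the partial sums at -1 and at 1; here
   [4 = -2 * (q0 - t)]. *)
- apply: (@bigO_exp_series _ _ _ _ 4 1 hr) => n.
  by rewrite endsaa mulrBl -mulrA qdiff0_fact qseq_fact eV /e; ring.
- apply: (@bigO_exp_series _ _ _ _ (-2) 0 hr) => n.
  by rewrite endsb qdiff0_fact eV /=; ring.
- apply: (@bigO_exp_series _ _ _ _ 1 0 hr) => n.
  by rewrite endsb qdiff0_fact eV /=; ring.
- apply: (@bigO_exp_series _ _ _ _ 1 1 hr) => n.
  by rewrite alphaE wsum_all mulrBl qdiff0_fact qdiffn0 qseq_fact eV /e; ring.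
Qed.
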